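(* Let $n\geq 2$ be an integer and let $G\leq \operatorname{Homeo}(S^1)$ be any subgroup containing the Thompson group $T_n$ (in the case $n=2$, $T_2=T$ is Thompson's group $T$). Then the group Zariski topology $\mathfrak{Z}_G$ on $G$ is equal to the compact-open topology on $G$. In particular, $\mathfrak{Z}_G$ is a Hausdorff group topology on $G$.
   Context: A group topology on a group $G$ is a topology on the set $G$ for which multiplication $G\times G\to G$ and inversion $G\to G$ are continuous. The group Zariski topology $\mathfrak{Z}_G$ on a group $G$ with identity $1_G$ is the topology on $G$ with subbasis consisting of the sets $\{x\in G \mid 1_G\neq g_0x^{k_0}g_1\cdots g_{l-1}x^{k_{l-1}}g_l\}$, where $l\in\mathbb{N}=\{0,1,2,\ldots\}$, $g_0,\ldots,g_l\in G$ and $k_0,\ldots,k_{l-1}\in\mathbb{Z}$. $S^1\cong\mathbb{R}/\mathbb{Z}$ is the circle and $\operatorname{Homeo}(S^1)$ is the group of all homeomorphisms of $S^1$ under composition. The compact-open topology on $\operatorname{Homeo}(X)$ has subbasis the sets $\{f\in\operatorname{Homeo}(X)\mid f(K)\subseteq U\}$ with $K\subseteq X$ compact and $U\subseteq X$ open; a subgroup $G$ carries the subspace topology, also called the compact-open topology on $G$. The Thompson group $T_n$ is the group of orientation-preserving piecewise linear homeomorphisms of $S^1=\mathbb{R}/\mathbb{Z}$ (with finitely many pieces) having all slopes in $\{n^k\mid k\in\mathbb{Z}\}$, all breakpoints in $\mathbb{Z}[\frac1n]/\mathbb{Z}$, and mapping $\mathbb{Z}[\frac1n]/\mathbb{Z}$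 onto itself. *)

(* Defs.v *)
From HB Require Import structures.
From mathcomp Require Import all_boot all_order all_algebra.
From mathcomp Require Import all_classical all_reals all_analysis.
Import Order.TTheory GRing.Theory Num.Theory.
Import numFieldNormedType.Exports.
Set Implicit Arguments.
Unset Strict Implicit.
Unset Printing Implicit Defensive.
Local Open Scope classical_set_scope.
Local Open Scope ring_scope.

HB.structure Definition PreTopologicalGroup := {G of Topological G & Group G}.

Definition group_topology (G : PreTopologicalGroup.type) : Prop :=
  continuous (fun p : G * G => (p.1 * p.2)%g) /\
  continuous (fun x : G => (x^-1)%g).

Section Zariski.
Variable G : groupType.

Definition expgz (x : G) (k : int) : G :=
  match k with Posz n => (x ^+ n)%g | Negz n => (x ^- n.+1)%g end.

Definition zariski_subbase : set (set G) :=
  [set U | exists (l : nat) (g : nat -> G) (k : nat -> int),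
    U = [set x | (1 <> g 0%N * \prod_(i < l) (expgz x (k i) * g i.+1))%g]].

Definition zariski : Type := G.
HB.instance Definition _ := Group.on zariski.
HB.instance Definition _ :=
  isSubBaseTopological.Build zariski zariski_subbase id.

End Zariski.

Section Subgroup.
Variables (G : groupType) (S : groupClosed G).

Definition subgroup : Type := {x : G | x \in S}.
HB.instance Definition _ := SubChoice.on subgroup.
HB.instance Definition _ := SubChoice_isSubGroup.Build G (fun x => x \in S) subgroup
  (conj gpred1 (@gpredF _ S)).

End Subgroup.

Section Homeo.
Variable X : topologicalType.

Definition homeomorphism (f : X -> X) : Prop :=
  continuous f /\ exists g : X -> X, [/\ continuous g, cancel f g & cancel g f].

(* [set_type] carries the subspace topology, here that of the compact-open
   topology on all maps X -> X. *)
Definition homeo : Type :=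
  set_type [set f : {compact-open, X -> X} | homeomorphism f].
HB.instance Definition _ := Topological.on homeo.

Definition homeo_fun (f : homeo) : X -> X := set_val f.
Coercion homeo_fun : homeo >-> Funclass.

Lemma homeoP (f : homeo) : homeomorphism f.
Proof. exact: (set_valP f). Qed.

Lemma homeo_inj : injective homeo_fun.
Proof. by move=> f g /val_inj. Qed.

Definition mk_homeo (f : X -> X) (hf : homeomorphism f) : homeo :=
  SigSub (mem_set hf).

Lemma mk_homeoE f hf : @mk_homeo f hf = f :> (X -> X).
Proof. by []. Qed.

Lemma homeomorphism_id : homeomorphism id.
Proof. by split=> [x|]; [exact: cvg_id|exists id; split=> // x; exact: cvg_id]. Qed.

Lemma homeomorphism_comp (f g : homeo) : homeomorphism (f \o g).
Proof.
have [cf [f' [cf' fK f'K]]] := homeoP f.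
have [cg [g' [cg' gK g'K]]] := homeoP g.
split; first by move=> x; apply: continuous_comp; [exact: cg|exact: cf].
exists (g' \o f'); split; [|exact: can_comp|exact: can_comp].
by move=> x; apply: continuous_comp; [exact: cf'|exact: cg'].
Qed.

Lemma homeo_inv_ex (f : homeo) :
  exists g : X -> X, [/\ continuous g, cancel f g & cancel g f].
Proof. by have [] := homeoP f. Qed.

Definition homeo_inv_fun (f : homeo) : X -> X := projT1 (cid (homeo_inv_ex f)).

Lemma homeo_inv_funP (f : homeo) : [/\ continuous (homeo_inv_fun f),
  cancel f (homeo_inv_fun f) & cancel (homeo_inv_fun f) f].
Proof. exact: projT2 (cid (homeo_inv_ex f)). Qed.

Lemma homeomorphism_inv (f : homeo) : homeomorphism (homeo_inv_fun f).
Proof.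
by have [cg fK gK] := homeo_inv_funP f; split=> //; exists f; split => //;
  case: (homeoP f).
Qed.

Definition homeo_one : homeo := mk_homeo homeomorphism_id.
Definition homeo_mul (f g : homeo) : homeo := mk_homeo (homeomorphism_comp f g).
Definition homeo_inv (f : homeo) : homeo := mk_homeo (homeomorphism_inv f).

Lemma homeo_mulA : associative homeo_mul.
Proof. by move=> f g h; exact: homeo_inj. Qed.
Lemma homeo_mul1g : left_id homeo_one homeo_mul.
Proof. by move=> f; apply: homeo_inj. Qed.
Lemma homeo_mulg1 : right_id homeo_one homeo_mul.
Proof. by move=> f; apply: homeo_inj. Qed.
Lemma homeo_mulVg : left_inverse homeo_one homeo_inv homeo_mul.
Proof.
move=> f; apply: homeo_inj; apply: funext => x /=.
by have [_ + _] := homeo_inv_funP f; exact.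
Qed.
Lemma homeo_mulgV : right_inverse homeo_one homeo_inv homeo_mul.
Proof.
move=> f; apply: homeo_inj; apply: funext => x /=.
by have [_ _ +] := homeo_inv_funP f; exact.
Qed.

HB.instance Definition _ := isGroup.Build homeo
  homeo_mulA homeo_mul1g homeo_mulg1 homeo_mulVg homeo_mulgV.

End Homeo.

Definition compact_open_subgroup (X : topologicalType)
    (S : groupClosed (homeo X)) : Type :=
  initial_topology (val : subgroup S -> homeo X).
HB.instance Definition _ X S := Topological.on (@compact_open_subgroup X S).

(* [Num.int] is a qualifier and cannot carry the closure structure required by
   [Quotient.quot]. *)
Definition integers (R : realType) : {pred R} := fun x => x \is a Num.int.
Arguments integers : clear implicits.
HB.instance Definition _ (R : realType) :=
  GRing.isZmodClosed.Build R (integers R)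
    (GRing.subring_closedB (@Num.Theory.int_num_subring R)).

Definition circle (R : realType) : Type :=
  quotient_topology (Quotient.quot (integers R)).
HB.instance Definition _ (R : realType) := Topological.on (circle R).
HB.instance Definition _ (R : realType) :=
  let Q := Quotient.quot (integers R) in
  GRing.isZmodule.Build (circle R) (@addrA Q) (@addrC Q) (@add0r Q) (@addNr Q).

Section Thompson.
Variable R : realType.

Definition to_circle (x : R) : circle R :=
  \pi_(quotient_topology (Quotient.quot (integers R)))%qT x.

Definition orientation_preserving (f : circle R -> circle R) : Prop :=
  exists F : R -> R, [/\ continuous F, {homo F : x y / x < y} &
    forall x, to_circle (F x) = f (to_circle x)].

Definition slope_at (f : circle R -> circle R) (p : circle R) (c : R) : Prop :=
  \forall h \near (0 : R), f (p + to_circle h) = f p + to_circle (c * h).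

Definition breakpoint (f : circle R -> circle R) : set (circle R) :=
  [set p | ~ exists c, slope_at f p c].

(* For a homeomorphism, finitely many breakpoints means finitely many pieces:
   on each complementary open arc the local slope is locally constant, hence
   constant. *)
Definition piecewise_linear (f : circle R -> circle R) : Prop :=
  finite_set (breakpoint f).

Definition nadic (n : nat) : set (circle R) :=
  [set to_circle (m%:~R / n%:R ^+ k) | m in [set: int] & k in [set: nat]].

Definition thompsonT (n : nat) : set (homeo (circle R)) :=
  [set f : homeo (circle R) |
    [/\ orientation_preserving f, piecewise_linear f,
        forall p c, slope_at f p c -> exists k : int, c = n%:R ^ k,
        breakpoint f `<=` nadic n & f @` nadic n = nadic n]].

End Thompson.
Arguments thompsonT : clear implicits.

(* Main.v *)
From HB Require Import structures.
Require Import Defs.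
From mathcomp Require Import all_boot all_order all_algebra.
From mathcomp Require Import all_classical all_reals all_analysis.
From mathcomp Require Import finmap ring lra zify.
Import Order.TTheory GRing.Theory Num.Theory.
Import numFieldNormedType.Exports.
Set Implicit Arguments.
Unset Strict Implicit.
Unset Printing Implicit Defensive.
Local Open Scope classical_set_scope.
Local Open Scope ring_scope.

(** Both inclusions between the two topologies come down to evaluating
homeomorphisms at points.

For a compact Hausdorff space X, the compact-open topology on its
homeomorphisms makes evaluation and evaluation of the inverse jointly
continuous ([homeo_eval_continuous], [homeo_inv_eval_continuous]), and a map
into [homeo X] is continuous as soon as its uncurried form is
([continuous_to_homeo]). So [homeo X] is a Hausdorff topological group, word
maps are continuous, and the sets where a word does not take the value 1 are
open: this is [compact_open_to_zariski].

Conversely, the only Zariski-open sets that are needed are those of the form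
{ f | f a f^-1 does not commute with b }. If a is supported in V and b in W,
then f a f^-1 is supported in f(V), so failure to commute forces f(V) to meet
W. When f0(V) meets W, suitable a and b with f0 in the corresponding set exist
provided that the group contains nontrivial elements supported in arbitrary
nonempty open sets ([zariski_hit]). The Thompson group does: inside any arc
there is an n-adic interval carrying a bump of slope n followed by slope 1/n
([thompson_micro_supported]). Hence each condition of the form f(V) meets W
which holds at f0 holds in a Zariski neighbourhood of f0.

On the circle three such conditions control f on a whole arc. Suppose that f
sends two points a and b into an arc J and a third point c, outside the arc
from a to b, into the complementary arc. Cut the circle at f(c): along the arc
from a to b, f is a continuous injective real function, hence monotone, hence
its values stay between f(a) and f(b), inside J ([homeo_arc]). Since J may be
taken short and a, b on both sides of a given point, evaluation is jointly
continuous for the Zariski topology ([zariski_eval_near]), and therefore the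
Zariski topology is finer than the compact-open one
([zariski_to_compact_open]). The Hausdorff property and the continuity of the
group operations are then transported along the equality. *)

(** * The circle as a quotient of the real line *)

Section CircleTopology.
Variable R : realType.
Local Notation pi := (@to_circle R).

Lemma to_circleD : {morph pi : x y / x + y}.
Proof.
move=> x y; have := raddfD (\pi_(Quotient.quot (integers R)))%qT x y.
exact.
Qed.

Lemma to_circleP x y : pi x = pi y <-> x - y \is a Num.int.
Proof.
have := Quotient.idealrBE (integers R) x y; rewrite /integers unfold_in => ->.
by rewrite -(rwP eqP).
Qed.

Lemma to_circle_surj (p : circle R) : exists x, p = pi x.
Proof. by exists (repr p); rewrite /to_circle reprK. Qed.

Lemma to_circle_continuous : continuous pi.
Proof. exact: pi_continuous. Qed.

Lemma circle_openE (U : set (circle R)) : open U = open (pi @^-1` U).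
Proof. by []. Qed.

Lemma to_circleDz x m : pi (x + m%:~R) = pi x.
Proof. by apply/to_circleP; rewrite addrC addKr intr_int. Qed.

(** The preimage of the image of U is the union of the integer translates of U. *)
Lemma to_circle_open (U : set R) : open U -> open (pi @` U).
Proof.
move=> oU; rewrite circle_openE openE => x [y Uy /to_circleP/intrP[m yxm]].
have xE : y - m%:~R = x by rewrite -yxm subKr.
have ct : continuous (fun z : R => z + m%:~R).
  by move=> z; apply: cvgD; [exact: cvg_id|exact: cvg_cst].
have : \forall z \near x, U (z + m%:~R).
  apply: (ct x); apply: open_nbhs_nbhs; split=> //.
  by rewrite -xE subrK.
by apply: filterS => z Uz; exists (z + m%:~R) => //; exact: to_circleDz.
Qed.

(** Neighbourhoods in the circle can be computed upstairs because the projection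
    is both continuous and open. *)
Lemma nbhs_to_circle x (A : set (circle R)) :
  nbhs (pi x) A <-> \forall y \near x, A (pi y).
Proof.
split; first by move=> /(@to_circle_continuous x).
rewrite -[X in X -> _]/(nbhs x (pi @^-1` A)) !nbhsE => -[U [oU Ux] UA].
apply: (ex_intro2 _ _ (pi @` U)).
  by split; [exact: to_circle_open|exists x].
by move=> _ [y Uy <-]; exact: UA.
Qed.

Lemma to_circle_inj x y : `|x - y| < 1 -> pi x = pi y -> x = y.
Proof.
move=> xy /to_circleP/intrP[m mE].
move: xy; rewrite mE -intr_norm -[1]/(1%:~R) ltr_int => m1.
by apply/eqP; rewrite -subr_eq0 mE (_ : m = 0) //; lia.
Qed.

Definition fpart (x : R) : R := x - (Num.floor x)%:~R.

Lemma fpart_itv x : 0 <= fpart x < 1.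
Proof. by have := floor_itv x; rewrite /fpart intrD; lra. Qed.

Lemma fpartDz x m : fpart (x + m%:~R) = fpart x.
Proof. by rewrite /fpart floorDrz ?intr_int // intrKfloor intrD; lra. Qed.

Lemma fpart_id x : 0 <= x < 1 -> fpart x = x.
Proof. by move=> x01; rewrite /fpart (@floor_def _ _ 0) ?subr0. Qed.

Lemma to_circle_fpart x : pi (fpart x) = pi x.
Proof. by rewrite /fpart -intrN to_circleDz. Qed.

(** The coordinate of the circle cut at the point v, with values from v
    (included) to v + 1 (excluded): the inverse of the projection there. *)
Definition chart (v : R) (p : circle R) : R := v + fpart (repr p - v).

Lemma chartE v x : chart v (pi x) = v + fpart (x - v).
Proof.
rewrite /chart; congr (_ + _).
have /intrP[m xm] : repr (pi x) - x \is a Num.int.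
  by apply/to_circleP; rewrite /to_circle reprK.
by rewrite (_ : repr _ - v = x - v + m%:~R) ?fpartDz // -xm; lra.
Qed.

Lemma chartK v : cancel (chart v) pi.
Proof.
move=> p; have [x ->] := to_circle_surj p.
by rewrite chartE to_circleD to_circle_fpart -to_circleD subrKC.
Qed.

Lemma chart_itv v p : v <= chart v p < v + 1.
Proof. by rewrite /chart; have := fpart_itv (repr p - v); lra. Qed.

Lemma chart_id v x : v <= x < v + 1 -> chart v (pi x) = x.
Proof. by move=> xv; rewrite chartE fpart_id; lra. Qed.

(** The chart only jumps at the cut: elsewhere its value lies in the open
    interval, where the chart inverts the projection. *)
Lemma chart_continuous v p : p <> pi v -> {for p, continuous (chart v)}.
Proof.
move=> pv; have := chart_itv v p; have := chartK v p.
set x := chart v p => xp xv A.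
have {}xv : v < x < v + 1.
  suff : x != v by lra.
  by apply: contra_notN pv => /eqP <-.
move=> Ax; rewrite -xp; apply/nbhs_to_circle.
have x0 : nbhs x `]v, v + 1[%classic.
  by apply: open_nbhs_nbhs; split; [exact: interval_open|rewrite /= in_itv].
near=> y; rewrite /= chart_id; first by near: y.
suff : v < y < v + 1 by lra.
by have := near x0 y; rewrite /= in_itv /=; apply.
Unshelve. all: by end_near. Qed.

(** Two points of the circle are always both away from some cut, and the chart
    at this cut is injective and continuous at both of them; so the Hausdorff
    property comes from the real line. *)
Lemma circle_hausdorff : hausdorff_space (circle R).
Proof.
move=> p q pq; have [x pE] := to_circle_surj p.
have := chart_itv x q; set y := chart x q => yx.
(* The cut is placed midway between the lift y of q and the next lift of p. *)
pose v := (y + (x + 1)) / 2.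
have vE t : x <= t -> t < v -> pi t <> pi v.
  move=> xt tv /to_circleP/intrP[m tm].
  have : (-1)%:~R < m%:~R :> R by rewrite -tm /v; rewrite /v in tv; lra.
  have : m%:~R < 0%:~R :> R by rewrite -tm; lra.
  by rewrite !ltr_int; lia.
have pv : p <> pi v by rewrite pE; apply: vE; rewrite // /v; lra.
have qv : q <> pi v by rewrite -(chartK x q); apply: vE; rewrite // /v -/y; lra.
apply: (can_inj (chartK v)); apply: norm_hausdorff => A B Ap Bq.
have [z [Az Bz]] := pq _ _ (chart_continuous pv Ap) (chart_continuous qv Bq).
by exists (chart v z).
Qed.

Lemma circle_compact : compact [set: circle R].
Proof.
have -> : [set: circle R] = pi @` `[0, 1]%classic.
  apply/seteqP; split=> // p _; exists (chart 0 p); last exact: chartK.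
  by have := chart_itv 0 p; rewrite /= in_itv /=; lra.
apply: continuous_compact; last exact: segment_compact.
apply: continuous_subspaceT; exact: to_circle_continuous.
Qed.

End CircleTopology.

(** * Homeomorphism groups of compact Hausdorff spaces *)

Lemma compact_locally_compact (X : topologicalType) :
  compact [set: X] -> locally_compact [set: X].
Proof.
move=> cX x _; rewrite withinET; exists setT; first exact: filterT.
by split=> //; exact: closedT.
Qed.

Section HomeoTopology.
Variable X : topologicalType.
Hypotheses (cX : compact [set: X]) (hX : hausdorff_space X).

Lemma homeo_continuous (f : homeo X) : continuous f.
Proof. by case: (homeoP f). Qed.

Lemma homeoVK (f : homeo X) : cancel (homeo_inv f) f.
Proof. by have [_ _] := homeo_inv_funP f. Qed.

Lemma homeoK (f : homeo X) : cancel f (homeo_inv f).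
Proof. by have [_] := homeo_inv_funP f. Qed.

Lemma homeo_eval_continuous :
  continuous (fun z : homeo X * X => z.1 z.2).
Proof.
rewrite (_ : (fun z => _) = uncurry (@homeo_fun X)); last first.
  by apply: funext => -[].
apply: continuous_uncurry => //.
- exact: compact_locally_compact.
- exact: (@initial_continuous _ _ (set_val : homeo X -> {compact-open, X -> X})).
- exact: homeo_continuous.
Qed.

(** Let V be an open neighbourhood of f^-1(x). The compact set f(~V) misses x, so
    regularity provides a neighbourhood W of x whose closure it misses as well. A
    homeomorphism g which still sends ~V off the closure of W satisfies
    g^-1(W) <= V, and these g form a subbasic open set of the compact-open
    topology. *)
Lemma homeo_inv_eval_continuous :
  continuous (fun z : homeo X * X => (homeo_inv z.1) z.2).
Proof.
move=> z U; pose f : homeo X := z.1; pose x : X := z.2.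
rewrite nbhsE => -[V [oV Vx] VU].
have cK : compact (f @` ~` V).
  apply: continuous_compact.
    by apply: continuous_subspaceT; exact: homeo_continuous.
  by apply: (subclosed_compact _ cX) => //; exact: open_closedC.
have reg := compact_regular hX cX (filterT : nbhs x [set: X]).
have : nbhs x (~` (f @` ~` V)).
  apply: open_nbhs_nbhs; split.
    by apply: closed_openC; exact: compact_closed.
  by move=> [y nVy yx]; apply: nVy; rewrite -(homeoK f y) yx.
move=> /reg[W Wx WK].
pose C : set (homeo X) := [set g | homeo_fun g @` (~` V) `<=` ~` closure W].
exists (C, W); last first.
  move=> [g y] /= [Cg Wy]; apply: VU; apply: contrapT => nV.
  have := Cg y; apply; last exact: subset_closure.
  by exists ((homeo_inv g) y) => //; exact: homeoVK.
split=> //=; apply: open_nbhs_nbhs; split; last first.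
  by move=> y fy Wy; exact: (WK _ Wy).
exists [set g | g @` (~` V) `<=` ~` closure W] => //.
apply: compact_open_open; last by apply: closed_openC; exact: closed_closure.
by apply: (subclosed_compact _ cX) => //; exact: open_closedC.
Qed.

(** One half of the exponential law: continuity into [homeo X] becomes
    continuity of a map into X. *)
Lemma continuous_to_homeo (Z : topologicalType) (F : Z -> homeo X) :
  continuous (fun z : Z * X => F z.1 z.2) -> continuous F.
Proof.
move=> cF; apply: (@continuous_comp_initial _ _ _
  (set_val : homeo X -> {compact-open, X -> X})).
exact: (@continuous_curry_fun _ _ _ (fun z : Z * X => F z.1 z.2)).
Qed.

Lemma homeo_eval_cvg (T : Type) (F : set_system T) (h : T -> homeo X)
    (c : T -> X) (f : homeo X) (x : X) : Filter F ->
  h t @[t --> F] --> f -> c t @[t --> F] --> x -> h t (c t) @[t --> F] --> f x.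
Proof.
move=> FF hf cx.
exact: (@cvg_comp _ _ _ (fun t => (h t, c t)) _ _ _ _ (cvg_pair hf cx)
  (@homeo_eval_continuous (f, x))).
Qed.

Lemma homeo_hausdorff : hausdorff_space (homeo X).
Proof.
move=> f g fg; apply: homeo_inj; apply: funext => x.
apply: hX => A B Afx Bgx.
have cx (h : homeo X) : (fun h' : homeo X => h' x) @ h --> h x.
  exact (@homeo_eval_cvg _ _ id (fun=> x) h x (nbhs_filter h) cvg_id
    (@cvg_cst _ x _ _ (nbhs_filter h))).
have [h [Ah Bh]] := fg _ _ (cx f _ Afx) (cx g _ Bgx).
by exists (homeo_fun h x).
Qed.

Lemma homeo_mul_continuous :
  continuous (fun p : homeo X * homeo X => homeo_mul p.1 p.2).
Proof.
apply: continuous_to_homeo => z.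
have c1 : z'.1.1 @[z' --> z] --> z.1.1.
  exact: (@continuous_comp _ _ _ fst fst z cvg_fst cvg_fst).
have c2 : z'.1.2 @[z' --> z] --> z.1.2.
  exact: (@continuous_comp _ _ _ fst snd z cvg_fst cvg_snd).
have c3 := homeo_eval_cvg (nbhs_filter z) c2 cvg_snd.
exact: (homeo_eval_cvg (nbhs_filter z) c1 (c3 _)).
Qed.

Lemma homeo_inv_continuous : continuous (@homeo_inv X).
Proof. by apply: continuous_to_homeo; exact: homeo_inv_eval_continuous. Qed.

End HomeoTopology.

(** * Supports of homeomorphisms *)

Section Supports.
Variable X : topologicalType.
Implicit Types (f g a b c : homeo X) (U V W : set X).

Lemma homeo_mulE f g p : homeo_fun (f * g)%g p = f (g p).
Proof. by []. Qed.

Lemma homeo_invE f : homeo_fun f^-1%g = homeo_inv f.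
Proof. by []. Qed.

Definition supported (a : homeo X) (U : set X) : Prop := forall p, ~ U p -> a p = p.

Lemma homeo_injective f : injective f.
Proof. exact: can_inj (homeoK f). Qed.

(** If p is in U and a(p) is not, then a fixes a(p), so a(p) = p by injectivity. *)
Lemma supported_stable a U p : supported a U -> U p -> U (a p).
Proof.
move=> aU Up; apply: contrapT => nU; apply: (nU).
by rewrite (homeo_injective (aU _ nU)).
Qed.

Lemma supported_conj f a U :
  supported a U -> supported (f * a * f^-1)%g (f @` U).
Proof.
move=> aU p np; rewrite !homeo_mulE homeo_invE aU ?homeoVK // => Up; apply: np.
by exists (homeo_inv f p) => //; rewrite homeoVK.
Qed.

Lemma disjoint_supported_commute a b U V : supported a U -> supported b V ->
  (forall p, U p -> ~ V p) -> (a * b)%g = (b * a)%g :> homeo X.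
Proof.
move=> aU bV UV; apply: homeo_inj; apply: funext => p; rewrite !homeo_mulE.
have [Up|nUp] := pselect (U p).
  have Uap := supported_stable aU Up.
  by rewrite (bV p (UV _ Up)) (bV _ (UV _ Uap)).
rewrite (aU _ nUp); have [Vp|nVp] := pselect (V p).
  by rewrite aU // => Ubp; apply: (UV _ Ubp); exact: supported_stable.
by rewrite bV // aU.
Qed.

Definition micro_supported (H : set (homeo X)) : Prop :=
  forall U, open U -> U !=set0 ->
  exists b, [/\ H b, b <> homeo_one X & supported b U].

Lemma homeo_neq1 a : a <> homeo_one X -> exists p, a p <> p.
Proof.
move=> a1; apply/existsNP => ap; apply: a1; apply: homeo_inj; exact: funext.
Qed.

(** Since c moves y, a small neighbourhood W' of y is disjoint from c(W'). A
    nontrivial b supported in W' cannot commute with c, since its conjugate by c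
    is supported in c(W'). *)
Lemma micro_supported_noncommuting H c W y :
  hausdorff_space X -> micro_supported H -> open W -> W y -> c y <> y ->
  exists b, [/\ H b, supported b W & (c * b)%g <> (b * c)%g :> homeo X].
Proof.
move=> hX rH oW Wy cy.
have := hX; rewrite open_hausdorff => /(_ y (c y)).
have /eqP ycy : y <> c y by apply: nesym.
move=> /(_ ycy)[[A B] /= [/set_mem Ay /set_mem Bcy] [oA oB AB0]].
pose W' := W `&` (A `&` c @^-1` B).
have oW' : open W'.
  apply: openI => //; apply: openI => //.
  by apply: open_comp => // x _; exact: homeo_continuous.
have [|b [Hb b1 bW']] := rH W' oW'; first by exists y.
have [q bq] := homeo_neq1 b1.
exists b; split=> //.
  by move=> p nWp; apply: bW' => -[].
move=> /(congr1 (fun h : homeo X => h q)); rewrite !homeo_mulE => cbq.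
have [_ [_ Bcq]] : W' q by apply: contrapT => nq; apply: bq; exact: bW'.
apply: bq; apply: (@homeo_injective c); rewrite cbq.
apply: bW' => -[_ [Acq _]].
have : (A `&` B) (c q) by [].
by rewrite (eqP AB0).
Qed.

End Supports.

(** * The group Zariski topology *)

Section ZariskiTopology.
Variable G : groupType.

Lemma zariski_subbase_open (U : set (zariski G)) : zariski_subbase U -> open U.
Proof.
move=> sU; exists [set U]; last by rewrite bigcup_set1.
move=> _ ->; exists (fset1 U); last by rewrite set_fset1 bigcap_set1.
by move=> _ /[!inE] /eqP ->; exact: mem_set sU.
Qed.

Lemma continuous_to_zariski (T : topologicalType) (f : T -> zariski G) :
  (forall U, zariski_subbase U -> open (f @^-1` U)) -> continuous f.
Proof.
move=> fU; apply/continuousP => A [D Dfin <-].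
rewrite preimage_bigcup; apply: bigcup_open => B /Dfin[F FD <-].
rewrite preimage_bigcap bigcap_fset big_seq.
apply: big_ind => [||C CF]; [exact: openT|exact: openI|].
by apply: fU; exact: set_mem (FD _ CF).
Qed.

(** Commuting of f a f^-1 and b is the equation
    f a f^-1 b f a^-1 f^-1 b^-1 = 1, whose left side is a word in f. *)
Lemma zariski_commutator_open (a b : G) :
  open ([set f | f * a * f^-1 * b <> b * (f * a * f^-1)]%g : set (zariski G)).
Proof.
apply: zariski_subbase_open.
pose g (i : nat) : G := nth 1%g [:: 1; a; b; a^-1; b^-1]%g i.
pose k (i : nat) : int := nth 0 [:: 1; -1; 1; -1] i.
exists 4%N, g, k; apply: eq_set => f; apply/propext.
rewrite !big_ord_recr big_ord0 /= /g /k /= !expg1 !mul1g !mulgA.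
set X := (f * a / f * b)%g; set Y := (b * f * a / f)%g.
have -> : (X * f / a / f / b)%g = (X / Y)%g by rewrite /Y !invgM invgK !mulgA.
split; apply: contra_not => XY; first by rewrite -[X](mulgVK Y) -XY mul1g.
by rewrite XY mulgV.
Qed.

End ZariskiTopology.

Section Hit.
Variables (X : topologicalType) (G : groupClosed (homeo X)).
Hypotheses (hX : hausdorff_space X) (rG : micro_supported [set` G]).

Definition act (f : subgroup G) : X -> X := homeo_fun (val f).

Lemma subgroup_mulE (f g : subgroup G) : val (f * g)%g = (val f * val g)%g.
Proof. by []. Qed.

Lemma subgroup_invE (f : subgroup G) : val (f^-1)%g = (val f)^-1%g.
Proof. by []. Qed.

(** The neighbourhood consists of the f such that f a f^-1 does not commute with
    b. Here a is supported so close to p that f0 a f0^-1 is supported in W, and b,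
    supported in W, is then chosen so that f0 satisfies the condition. *)
Lemma zariski_hit (f0 : zariski (subgroup G)) (V W : set X) (p : X) :
  open V -> open W -> V p -> W (act f0 p) ->
  \forall f \near f0, exists2 q, V q & W (act f q).
Proof.
move=> oV oW Vp Wp; pose h0 : homeo X := val (f0 : subgroup G).
pose V' := V `&` h0 @^-1` W.
have oV' : open V'.
  by apply: openI => //; apply: open_comp => // x _; exact: homeo_continuous.
have [|a [Ga a1 aV]] := rG oV'; first by exists p.
have [q aq] := homeo_neq1 a1.
have V'q : V' q by apply: contrapT => nq; apply: aq; exact: aV.
pose c := (h0 * a * h0^-1)%g : homeo X.
have cy : c (h0 q) <> h0 q.
  rewrite /c !homeo_mulE homeo_invE homeoK => /homeo_injective; exact: aq.
have [b [Gb bW cb]] := micro_supported_noncommuting hX rG oW V'q.2 cy.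
pose a' : subgroup G := exist _ a Ga; pose b' : subgroup G := exist _ b Gb.
have oO := zariski_commutator_open a' b'.
have Of0 : nbhs f0 [set f : zariski (subgroup G) |
    (f * a' * f^-1 * b' <> b' * (f * a' * f^-1))%g].
  apply: open_nbhs_nbhs; split=> //= /(congr1 val).
  rewrite !subgroup_mulE subgroup_invE; exact: cb.
apply: filterS Of0.
move=> f /= ab; apply: contrapT => nVW; apply: ab; apply: val_inj.
rewrite !subgroup_mulE subgroup_invE.
apply: (disjoint_supported_commute (supported_conj aV) bW).
by move=> _ [z [Vz _] <-] Wz; apply: nVW; exists z.
Qed.

End Hit.

(** * Circle maps induced by homeomorphisms of the unit interval *)

Section Periodization.
Variable R : realType.
Local Notation pi := (@to_circle R).

Definition unit_homeo (F : R -> R) : Prop :=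
  [/\ continuous F, {homo F : x y / x < y} &
      forall x, (x <= 0) || (1 <= x) -> F x = x].

(** The lift to the real line, commuting with integer translations, of
    [circle_map F]. *)
Definition periodize (F : R -> R) (x : R) : R := (Num.floor x)%:~R + F (fpart x).

Definition circle_map (F : R -> R) (p : circle R) : circle R :=
  pi (F (chart 0 p)).

Lemma circle_mapE F x : circle_map F (pi x) = pi (periodize F x).
Proof. by rewrite /circle_map chartE add0r subr0 /periodize addrC to_circleDz. Qed.

Lemma unit_homeo_itv F x : unit_homeo F -> 0 <= x < 1 -> 0 <= F x < 1.
Proof.
move=> [_ Flt Fid] /andP[x0 x1]; apply/andP; split.
  move: x0; rewrite le_eqVlt => /orP[/eqP <-|/Flt]; first by rewrite Fid ?lexx.
  by rewrite Fid ?lexx //; exact: ltW.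
by have := Flt _ _ x1; rewrite (Fid 1) ?lexx ?orbT.
Qed.

Lemma periodize_homo F : unit_homeo F -> {homo periodize F : x y / x < y}.
Proof.
move=> uF x y xy; have [_ Flt _] := uF; rewrite /periodize.
have : (Num.floor x <= Num.floor y) by apply: le_floor; exact: ltW.
rewrite le_eqVlt => /orP[/eqP xyE|].
  by rewrite xyE ltrD2l; apply: Flt; rewrite /fpart xyE; lra.
move=> fxy; have {fxy} : Num.floor x + 1 <= Num.floor y by lia.
rewrite -(ler_int R) intrD => xyE.
have := unit_homeo_itv uF (fpart_itv x); have := unit_homeo_itv uF (fpart_itv y).
lra.
Qed.

(** Near an integer m this removes the jump of the integer part: of the two
    arguments x - m and x - m + 1, one lies outside the open unit interval, where
    F is the identity, so its contribution is affine and cancels. *)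
Lemma periodize_eq F x m : unit_homeo F -> m%:~R - 1 < x < m%:~R + 1 ->
  periodize F x = m%:~R + F (x - m%:~R) + (F (x - m%:~R + 1) - 1) - (x - m%:~R).
Proof.
move=> [_ _ Fid] xm; rewrite /periodize.
have [xm0|xm0] := leP m%:~R x.
  have fx : Num.floor x = m by apply: floor_def; rewrite intrD; lra.
  by rewrite /fpart fx (Fid (_ + 1)); last lra; lra.
have fx : Num.floor x = m - 1 by apply: floor_def; rewrite subrK intrD; lra.
rewrite /fpart fx (Fid (x - m%:~R)); last lra.
rewrite intrD [(-1)%:~R](_ : _ = - 1 :> R) // opprD opprK addrA; lra.
Qed.

Lemma periodize_continuous F : unit_homeo F -> continuous (periodize F).
Proof.
move=> uF x; have [cF _ _] := uF.
set m := Num.floor x; have := floor_itv x; rewrite -/m intrD => xm.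
have nx : \forall y \near x, m%:~R - 1 < y < m%:~R + 1.
  have : nbhs x `]m%:~R - 1, m%:~R + 1[%classic.
    apply: open_nbhs_nbhs; split; first exact: interval_open.
    by rewrite /= in_itv /=; lra.
  by apply: filterS => y; rewrite /= in_itv.
pose G y := m%:~R + F (y - m%:~R) + (F (y - m%:~R + 1) - 1) - (y - m%:~R).
have GE y : m%:~R - 1 < y < m%:~R + 1 -> periodize F y = G y.
  exact: periodize_eq.
suff cG : G y @[y --> x] --> G x.
  move=> A; rewrite GE => [/cG GA|]; last lra.
  by apply: filterS2 nx GA => y ym; rewrite /= GE.
rewrite /G {G GE}.
have c1 : y - m%:~R @[y --> x] --> x - m%:~R.
  by apply: cvgB; [exact: cvg_id|exact: cvg_cst].
apply: cvgB => //; apply: cvgD; first apply: cvgD.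
- exact: cvg_cst.
- by apply: continuous_cvg => //; exact: cF.
- apply: cvgB; last exact: cvg_cst.
  apply: continuous_cvg; first exact: cF.
  by apply: cvgD => //; exact: cvg_cst.
Unshelve. all: by end_near. Qed.

Lemma circle_map_continuous F : unit_homeo F -> continuous (circle_map F).
Proof.
move=> uF; apply/quotient_continuous.
have -> : circle_map F \o \pi_(quotient_topology (Quotient.quot (integers R)))%qT
   = pi \o periodize F by apply: funext => x; exact: circle_mapE.
move=> x; apply: continuous_comp; first exact: periodize_continuous.
exact: to_circle_continuous.
Qed.

Lemma circle_mapK F F' : unit_homeo F -> cancel F F' ->
  cancel (circle_map F) (circle_map F').
Proof.
move=> uF FK p; rewrite /circle_map chart_id ?add0r ?FK ?chartK //.
by apply: unit_homeo_itv => //; have := chart_itv 0 p; rewrite add0r.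
Qed.

Lemma circle_map_homeo F F' : unit_homeo F -> unit_homeo F' ->
  cancel F F' -> cancel F' F -> homeomorphism (circle_map F).
Proof.
move=> uF uF' FK F'K; split; first exact: circle_map_continuous.
exists (circle_map F').
by split; [exact: circle_map_continuous| |]; exact: circle_mapK.
Qed.

Lemma circle_map_orientation F :
  unit_homeo F -> orientation_preserving (circle_map F).
Proof.
move=> uF; exists (periodize F); split; last by move=> x; rewrite circle_mapE.
  exact: periodize_continuous.
exact: periodize_homo.
Qed.

Lemma periodizeD F x h : 0 <= fpart x + h < 1 ->
  periodize F (x + h) = (Num.floor x)%:~R + F (fpart x + h).
Proof.
move=> xh; have fx : Num.floor (x + h) = Num.floor x.
  by apply: floor_def; rewrite intrD; move: xh; rewrite /fpart; lra.
by rewrite /periodize /fpart fx; congr (_ + F _); lra.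
Qed.

(** The slope at a point is determined by the germ on the right: for small h > 0,
    (c - c') h is an integer of absolute value less than 1. Working on the right
    avoids the discontinuity of [fpart] at the integers. *)
Lemma circle_map_slope F x c e : 0 < e ->
  (forall h, 0 <= h < e -> F (fpart x + h) = F (fpart x) + c * h) ->
  forall c', slope_at (circle_map F) (pi x) c' -> c' = c.
Proof.
move=> e0 Fc c' sc'; apply/eqP; rewrite -subr_eq0 -normr_le0 leNgt.
apply/negP => cc.
have := fpart_itv x => x01.
near (0:R)^'+ => h.
have h0 : 0 < h by near: h; exact: nbhs_right_gt.
have he : h < e by near: h; exact: nbhs_right_lt.
have h1 : h < 1 - fpart x by near: h; apply: nbhs_right_lt; lra.
have hc : h < `|c' - c|^-1 by near: h; apply: nbhs_right_lt; rewrite invr_gt0.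
have : circle_map F (pi x + pi h) = circle_map F (pi x) + pi (c' * h).
  by near: h; exact: cvg_within sc'.
rewrite -to_circleD !circle_mapE -to_circleD periodizeD; last lra.
rewrite Fc; last lra.
move=> /to_circleP; rewrite /periodize.
rewrite (_ : _ - _ = (c - c') * h); last lra.
have : `|(c - c') * h| < 1.
  by rewrite normrM distrC (gtr0_norm h0) mulrC -ltr_pdivlMr // mul1r.
move=> + /intrP[m mE]; rewrite mE -intr_norm -[1]/(1%:~R) ltr_int => m1.
have m0 : m = 0 by lia.
have /eqP := mE; rewrite m0 mulf_eq0 (gt_eqF h0) orbF => /eqP cE.
by have := cc; rewrite distrC cE normr0 ltxx.
Unshelve. all: by end_near. Qed.

(** Away from the point 0 of the circle, the integer part is constant near x. *)
Lemma circle_map_slope_at F x c : 0 < fpart x ->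
  (\forall h \near (0 : R), F (fpart x + h) = F (fpart x) + c * h) ->
  slope_at (circle_map F) (pi x) c.
Proof.
move=> x0 Fc; have := fpart_itv x => x01; rewrite /slope_at; near=> h.
have h0 : h < 1 - fpart x by near: h; apply: lt_nbhsl; lra.
have h1 : - fpart x < h by near: h; apply: lt_nbhsr; lra.
rewrite -to_circleD !circle_mapE -to_circleD periodizeD; last lra.
rewrite (_ : F (fpart x + h) = F (fpart x) + c * h) ?addrA //; near: h; exact: Fc.
Unshelve. all: by end_near. Qed.

End Periodization.

(** * Piecewise linear bumps with two reciprocal slopes *)

Section Bump.
Variable R : realType.

Definition clamp (a b x : R) : R := Num.min (Num.max x a) b.

(** The identity outside the interval from s to s + d + K d, with slope K on the
    first part, of length d, and slope V on the second, of length K d. With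
    K V = 1 the two parts exchange their lengths, which is why the graph returns to
    the diagonal. Writing it as a sum of clamped coordinates, each moving only
    across its own piece, makes continuity evident. *)
Definition plbump (K V s d x : R) : R :=
  Num.min x s + K * (clamp s (s + d) x - s) +
  V * (clamp (s + d) (s + d + K * d) x - (s + d)) +
  (Num.max x (s + d + K * d) - (s + d + K * d)).

(** V is kept as a parameter, rather than written as the inverse of K, so that
    inverting a bump amounts to exchanging K and V. *)
Definition bump_params (K V d : R) : Prop :=
  [/\ 0 < K, 0 < V, K * V = 1 & 0 < d].

Lemma bump_paramsP K V d : bump_params K V d ->
  [/\ 0 < K, 0 < V, 0 < d, 0 < K * d & V * (K * d) = d].
Proof.
move=> [K0 V0 KV d0]; split; rewrite ?mulr_gt0 //.
by rewrite mulrA [V * K]mulrC KV mul1r.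
Qed.

Variables (K V s d : R).
Hypothesis KVd : bump_params K V d.

Lemma clamp_below (a b x : R) : a <= b -> x <= a -> clamp a b x = a.
Proof. by move=> ab xa; rewrite /clamp (max_r xa) min_l. Qed.
Lemma clamp_inside (a b x : R) : a <= x -> x <= b -> clamp a b x = x.
Proof. by move=> ax xb; rewrite /clamp (max_l ax) min_l. Qed.
Lemma clamp_above (a b x : R) : a <= b -> b <= x -> clamp a b x = b.
Proof. by move=> ab bx; rewrite /clamp max_l ?min_r //; exact: le_trans bx. Qed.

Lemma plbump_before (x : R) : x <= s -> plbump K V s d x = x.
Proof.
have [K0 V0 d0 Kd0 VKd] := bump_paramsP KVd.
by move=> xs; rewrite /plbump min_l // !clamp_below ?max_r; lra.
Qed.

Lemma plbump_seg1 (x : R) : s <= x -> x <= s + d ->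
  plbump K V s d x = s + K * (x - s).
Proof.
have [K0 V0 d0 Kd0 VKd] := bump_paramsP KVd.
move=> xs xd; rewrite /plbump min_r // clamp_inside // clamp_below ?max_r; lra.
Qed.

Lemma plbump_seg2 (x : R) : s + d <= x -> x <= s + d + K * d ->
  plbump K V s d x = s + K * d + V * (x - (s + d)).
Proof.
have [K0 V0 d0 Kd0 VKd] := bump_paramsP KVd.
move=> xs xd; rewrite /plbump min_r ?(@clamp_above s) ?clamp_inside ?max_r; lra.
Qed.

Lemma plbump_after (x : R) : s + d + K * d <= x -> plbump K V s d x = x.
Proof.
have [K0 V0 d0 Kd0 VKd] := bump_paramsP KVd.
move=> xs; rewrite /plbump min_r ?clamp_above ?max_l; lra.
Qed.

Lemma minr_continuous (a : R) : continuous (fun x : R => Num.min x a).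
Proof.
move=> x; apply: (@continuous_min _ _ id (fun=> a)); first exact: cvg_id.
exact: cvg_cst.
Qed.

Lemma maxr_continuous (a : R) : continuous (fun x : R => Num.max x a).
Proof.
move=> x; apply: (@continuous_max _ _ id (fun=> a)); first exact: cvg_id.
exact: cvg_cst.
Qed.

Lemma clamp_continuous a b : continuous (clamp a b).
Proof.
move=> x.
apply: (@continuous_comp _ _ _ (fun x => Num.max x a) (fun x => Num.min x b)).
  exact: maxr_continuous.
exact: minr_continuous.
Qed.

Lemma plbump_continuous : continuous (plbump K V s d).
Proof.
move=> x; apply: cvgD; first apply: cvgD; first apply: cvgD.
- exact: minr_continuous.
- apply: cvgM; first exact: cvg_cst.
  by apply: cvgB; [exact: clamp_continuous|exact: cvg_cst].
- apply: cvgM; first exact: cvg_cst.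
  by apply: cvgB; [exact: clamp_continuous|exact: cvg_cst].
- apply: cvgB; last exact: cvg_cst.
  exact: maxr_continuous.
Qed.

Lemma clamp_le a b : {homo clamp a b : x y / x <= y}.
Proof.
by move=> x y xy; rewrite /clamp !(le_min2, le_max2).
Qed.

Lemma clamp_sum (x : R) : x = Num.min x s + (clamp s (s + d) x - s) +
  (clamp (s + d) (s + d + K * d) x - (s + d)) +
  (Num.max x (s + d + K * d) - (s + d + K * d)).
Proof.
have [K0 V0 d0 Kd0 VKd] := bump_paramsP KVd.
have [x1|x1] := leP x s; first by rewrite !clamp_below ?max_r; lra.
have [x2|x2] := leP x (s + d).
  by rewrite clamp_inside ?clamp_below ?max_r; lra.
have [x3|x3] := leP x (s + d + K * d).
  by rewrite clamp_above ?clamp_inside; lra.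
by rewrite !clamp_above; lra.
Qed.

(** The four clamped coordinates of x are nondecreasing and add up to x
    ([clamp_sum]), so at least one of them increases strictly from x to y; scaling
    them by the positive slopes preserves this. *)
Lemma plbump_homo : {homo plbump K V s d : x y / x < y}.
Proof.
have [K0 V0 d0 Kd0 VKd] := bump_paramsP KVd.
move=> x y xy.
have := clamp_sum x; have := clamp_sum y; rewrite /plbump.
have := clamp_le s (s + d) (ltW xy).
have := clamp_le (s + d) (s + d + K * d) (ltW xy).
have : Num.min x s <= Num.min y s by rewrite le_min2 // ltW.
have : Num.max x (s + d + K * d) <= Num.max y (s + d + K * d).
  by rewrite le_max2 // ltW.
set a := Num.min x s; set a' := Num.min y s.
set e := Num.max x _; set e' := Num.max y _.
set b := clamp s _ x; set b' := clamp s _ y.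
set c := clamp _ _ x; set c' := clamp _ _ y.
move=> ee aa cc bb sy sx.
have : 0 <= K * (b' - b) by apply: mulr_ge0; lra.
have : 0 <= V * (c' - c) by apply: mulr_ge0; lra.
have [/eqP b0|b0] := boolP (b' - b == 0).
  have [/eqP c0|c0] := boolP (c' - c == 0).
    have bE : b' = b by lra.
    have cE : c' = c by lra.
    by rewrite bE cE; lra.
  have : 0 < V * (c' - c) by apply: mulr_gt0; lra.
  by lra.
have : 0 < K * (b' - b) by apply: mulr_gt0; lra.
lra.
Qed.

Lemma plbump_unit :
  0 <= s -> s + d + K * d <= 1 -> unit_homeo (plbump K V s d).
Proof.
have [K0 V0 d0 Kd0 VKd] := bump_paramsP KVd.
move=> s0 s1; split; [exact: plbump_continuous|exact: plbump_homo|].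
by move=> x /orP[x0|x1]; [apply: plbump_before|apply: plbump_after]; lra.
Qed.

(** Stated with one-sided germs so that it holds at the breakpoints too: the
    slopes that occur anywhere can then be read off. *)
Lemma plbump_right_affine (x : R) : exists c e, [/\ c \in [:: 1; K; V], 0 < e &
  forall h, 0 <= h < e -> plbump K V s d (x + h) = plbump K V s d x + c * h].
Proof.
have [K0 V0 d0 Kd0 VKd] := bump_paramsP KVd.
have [x1|x1] := ltP x s.
  exists 1, (s - x); split; rewrite ?inE ?eqxx //; first lra.
  by move=> h hx; rewrite !plbump_before; lra.
have [x2|x2] := ltP x (s + d).
  exists K, (s + d - x); split; rewrite ?inE ?eqxx ?orbT //; first lra.
  by move=> h hx; rewrite !plbump_seg1; lra.
have [x3|x3] := ltP x (s + d + K * d).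
  exists V, (s + d + K * d - x); split; rewrite ?inE ?eqxx ?orbT //; first lra.
  by move=> h hx; rewrite !plbump_seg2; lra.
exists 1, 1; split; rewrite ?inE ?eqxx //.
by move=> h hx; rewrite !plbump_after; lra.
Qed.

Lemma plbump_locally_affine (x : R) :
  x != s -> x != s + d -> x != s + d + K * d ->
  exists c, \forall h \near (0 : R),
    plbump K V s d (x + h) = plbump K V s d x + c * h.
Proof.
have [K0 V0 d0 Kd0 VKd] := bump_paramsP KVd.
move=> xs xd xt.
have near_itv a b : a < x -> x < b -> \forall h \near (0 : R), a < x + h < b.
  move=> ax xb; near=> h; apply/andP; split.
    by rewrite -ltrBlDl; near: h; apply: lt_nbhsr; lra.
  by rewrite -ltrBrDl; near: h; apply: lt_nbhsl; lra.
have [x1|x1] := ltP x s.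
  exists 1; apply: filterS (near_itv (x - 1) s _ _) => [h hx||]; try lra.
  by rewrite !plbump_before; lra.
have [x2|x2] := ltP x (s + d).
  exists K; apply: filterS (near_itv s (s + d) _ _) => [h hx||]; try lra.
  by rewrite !plbump_seg1; lra.
have [x3|x3] := ltP x (s + d + K * d).
  exists V.
  apply: filterS (near_itv (s + d) (s + d + K * d) _ _) => [h hx||]; try lra.
  by rewrite !plbump_seg2; lra.
exists 1.
apply: filterS (near_itv (s + d + K * d) (x + 1) _ _) => [h hx||]; try lra.
by rewrite !plbump_after; lra.
Unshelve. all: by end_near. Qed.

End Bump.

Lemma bump_paramsV (R : realType) (K V d : R) :
  bump_params K V d -> bump_params V K (K * d).
Proof. by move=> [K0 V0 KV d0]; split; rewrite ?mulr_gt0 // mulrC. Qed.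

(** A bump maps its piece of slope K and length d onto an interval of length K d,
    where the bump with exchanged slopes has slope V; likewise for the other
    piece. *)
Lemma plbumpK (R : realType) (K V s d : R) : bump_params K V d ->
  cancel (plbump K V s d) (plbump V K s (K * d)).
Proof.
move=> KVd x; have VKd := bump_paramsV KVd.
have [K0 V0 d0 Kd0 VKdE] := bump_paramsP KVd.
have [_ _ KV1 _] := KVd.
have KV (y : R) : V * (K * y) = y by rewrite mulrA [V * K]mulrC KV1 mul1r.
have VK (y : R) : K * (V * y) = y by rewrite mulrA KV1 mul1r.
have [x1|x1] := leP x s.
  by rewrite (plbump_before KVd) // (plbump_before VKd).
have [x2|x2] := leP x (s + d).
  have : 0 <= K * (x - s) by apply: mulr_ge0; lra.
  have : 0 <= K * (s + d - x) by apply: mulr_ge0; lra.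
  move=> H1 H2; rewrite (plbump_seg1 KVd) //; try lra.
  rewrite (plbump_seg1 VKd) //; try lra.
  by rewrite [_ - s](_ : _ = K * (x - s)) ?KV; lra.
have [x3|x3] := leP x (s + d + K * d).
  have : 0 <= V * (x - (s + d)) by apply: mulr_ge0; lra.
  have : 0 <= V * (s + d + K * d - x) by apply: mulr_ge0; lra.
  move=> H1 H2; rewrite (plbump_seg2 KVd) //; try lra.
  rewrite (plbump_seg2 VKd) //; try lra.
  rewrite KV [_ - (s + _)](_ : _ = V * (x - (s + d))) ?VK; lra.
rewrite (plbump_after KVd) //; try lra.
by rewrite (plbump_after VKd) //; have := KV d; lra.
Qed.

(** * Elements of the Thompson group with small support *)

Section ThompsonElements.
Variables (R : realType) (n : nat).
Hypothesis n2 : (2 <= n)%N.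
Local Notation pi := (@to_circle R).
Local Notation N := (n%:R : R).

Let N0 : N != 0. Proof. by rewrite pnatr_eq0; lia. Qed.

Definition nadic_real (x : R) : Prop :=
  exists (m : int) (k : nat), x = m%:~R / N ^+ k.

Lemma nadic_real_int m : nadic_real m%:~R.
Proof. by exists m, 0%N; rewrite expr0 divr1. Qed.

Lemma nadic_realN x : nadic_real x -> nadic_real (- x).
Proof. by move=> [m [k ->]]; exists (- m), k; rewrite mulrNz mulNr. Qed.

Lemma nadic_realD x y : nadic_real x -> nadic_real y -> nadic_real (x + y).
Proof.
move=> [m [k ->]] [m' [k' ->]].
exists (m * n%:Z ^+ k' + m' * n%:Z ^+ k), (k + k')%N.
rewrite exprD intrD !intrM !rmorphXn /= -!pmulrn.
by field; rewrite !expf_neq0.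
Qed.

Lemma nadic_realM x : nadic_real x -> nadic_real (N * x).
Proof. by move=> [m [k ->]]; exists (n%:Z * m), k; rewrite intrM -pmulrn mulrA. Qed.

Lemma nadic_realV x : nadic_real x -> nadic_real (N^-1 * x).
Proof.
move=> [m [k ->]]; exists m, k.+1; rewrite exprS; field.
by rewrite N0 expf_neq0.
Qed.

Lemma nadicP p : nadic n p <-> nadic_real (chart 0 p).
Proof.
split=> [[m _ [k _ <-]]|[m [k mk]]]; last first.
  by exists m => //; exists k => //; rewrite -mk chartK.
rewrite chartE add0r subr0 /fpart -mulrNz.
by apply: nadic_realD; [exists m, k|exact: nadic_real_int].
Qed.

Lemma nadic_to_circle x : nadic_real x -> nadic n (pi x).
Proof. by move=> [m [k ->]]; exists m => //; exists k. Qed.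

Lemma nadic_circle_map F F' :
  (forall x, nadic_real x -> nadic_real (F x)) ->
  (forall x, nadic_real x -> nadic_real (F' x)) ->
  cancel (circle_map F') (circle_map F) -> circle_map F @` nadic n = nadic n.
Proof.
move=> nF nF' F'K; apply/seteqP; split=> [_ [p /nadicP np <-]|p /nadicP np].
  by apply: nadic_to_circle; exact: nF.
by exists (circle_map F' p); [apply: nadic_to_circle; exact: nF'|exact: F'K].
Qed.

Lemma plbump_nadic (K V s d x : R) : bump_params K V d ->
  (forall y, nadic_real y -> nadic_real (K * y)) ->
  (forall y, nadic_real y -> nadic_real (V * y)) ->
  nadic_real s -> nadic_real d -> nadic_real x -> nadic_real (plbump K V s d x).
Proof.
move=> KVd nK nV ns nd nx.
have nB y z : nadic_real y -> nadic_real z -> nadic_real (y - z).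
  by move=> ny nz; apply: nadic_realD => //; exact: nadic_realN.
have [x1|/ltW x1] := leP x s; first by rewrite (plbump_before KVd).
have [x2|/ltW x2] := leP x (s + d).
  by rewrite (plbump_seg1 KVd) //; apply: nadic_realD => //; apply: nK; exact: nB.
have [x3|/ltW x3] := leP x (s + d + K * d); last by rewrite (plbump_after KVd).
rewrite (plbump_seg2 KVd) //; apply: nadic_realD.
  by apply: nadic_realD => //; exact: nK.
by apply: nV; apply: nB => //; exact: nadic_realD.
Qed.

Lemma bump_paramsN (d : R) : 0 < d -> bump_params N N^-1 d.
Proof.
move=> d0; have N1 : 0 < N by rewrite ltr0n; lia.
by split; rewrite ?invr_gt0 ?mulfV.
Qed.

Section Element.
Variables s d : R.
Hypotheses (s0 : 0 <= s) (d0 : 0 < d) (sd1 : s + d + N * d <= 1).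
Hypotheses (ns : nadic_real s) (nd : nadic_real d).

Let f := plbump N N^-1 s d.
Let f' := plbump N^-1 N s (N * d).
Let sl := bump_paramsN d0.
Let slV := bump_paramsV sl.

Let dE : N^-1 * (N * d) = d. Proof. by case: (bump_paramsP sl). Qed.

Let uf : unit_homeo f. Proof. exact: plbump_unit. Qed.

Let uf' : unit_homeo f'.
Proof.
apply: plbump_unit => //; rewrite dE; move: sd1; lra.
Qed.

Let fK : cancel f f'. Proof. exact: plbumpK. Qed.

Let f'K : cancel f' f.
Proof. by move=> x; have := plbumpK s slV; rewrite dE; exact. Qed.

Definition thompson_bump : homeo (circle R) :=
  mk_homeo (circle_map_homeo uf uf' fK f'K).

(** The point 0 is listed because the fundamental domain is cut there; it
    is n-adic, so listing it is harmless. *)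
Lemma breakpoint_bump p : breakpoint (circle_map f) p ->
  [\/ p = pi 0, p = pi s, p = pi (s + d) | p = pi (s + d + N * d)].
Proof.
move=> bp; have := chartK 0 p; have := chart_itv 0 p; rewrite add0r.
set x := chart 0 p => x01 xp; rewrite -xp in bp *.
have fx : fpart x = x by exact: fpart_id.
have [->|x0] := eqVneq x 0; first by constructor 1.
have [->|xs] := eqVneq x s; first by constructor 2.
have [->|xd] := eqVneq x (s + d); first by constructor 3.
have [->|xt] := eqVneq x (s + d + N * d); first by constructor 4.
exfalso; apply: bp; have [c fc] := plbump_locally_affine sl xs xd xt.
by exists c; apply: circle_map_slope_at; rewrite fx //; lra.
Qed.

Lemma thompson_bumpP : thompsonT R n thompson_bump.
Proof.
split.
- exact: circle_map_orientation.
- apply: (@sub_finite_set _ _ [set pi 0; pi s; pi (s + d); pi (s + d + N * d)]).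
    by move=> p /breakpoint_bump[] -> /=; tauto.
  by rewrite !finite_setU; do !split; exact: finite_set1.
- move=> p c; rewrite -(chartK 0 p) => sc.
  have [c' [e [c'in e0 fe]]] := plbump_right_affine s sl (fpart (chart 0 p)).
  rewrite (circle_map_slope e0 fe sc).
  move: c'in; rewrite !inE => /or3P[] /eqP ->.
  + by exists 0.
  + by exists 1.
  + by exists (-1).
- move=> p /breakpoint_bump[] ->; apply: nadic_to_circle => //.
  + exact: (nadic_real_int 0).
  + exact: nadic_realD.
  + by apply: nadic_realD; [exact: nadic_realD|exact: nadic_realM].
- apply: (@nadic_circle_map f f'); last exact: (circle_mapK uf' f'K).
    move=> x; apply: plbump_nadic => //; first exact: nadic_realM.
    exact: nadic_realV.
  move=> x; apply: plbump_nadic => //; first exact: nadic_realV.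
    exact: nadic_realM.
  exact: nadic_realM.
Qed.

(** The breakpoint s + d is moved by (n - 1) d, which lies strictly between 0
    and 1. *)
Lemma thompson_bump_neq1 : thompson_bump <> homeo_one (circle R).
Proof.
have N2 : 2 <= N by rewrite ler_nat.
have Nd : 2 * d <= N * d by rewrite ler_pM2r.
move=> b1; have : chart 0 (pi (f (chart 0 (pi (s + d))))) = chart 0 (pi (s + d)).
  exact: (congr1 (fun g : homeo (circle R) => chart 0 (g (pi (s + d)))) b1).
have sdE : chart 0 (pi (s + d)) = s + d by apply: chart_id; move: s0 d0 sd1; lra.
have fsd : f (s + d) = s + N * d.
  by rewrite /f (plbump_seg1 sl); move: d0; lra.
rewrite sdE fsd chart_id; move: s0 d0 sd1; lra.
Qed.

Lemma thompson_bump_id p : ~ s < chart 0 p < s + d + N * d -> thompson_bump p = p.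
Proof.
move=> /negP; rewrite negb_and -!leNgt => /orP xs.
have fp : f (chart 0 p) = chart 0 p.
  by case: xs => ?; [apply: (plbump_before sl)|apply: (plbump_after sl)].
by rewrite -[RHS](chartK 0 p) -[in RHS]fp.
Qed.

End Element.

(** Every open arc contains the interval from s to s + (n + 1) d for
    d = n^-k with k large and some integer multiple s of d. *)
Lemma thompson_micro_supported : micro_supported (thompsonT R n).
Proof.
move=> U oU [p Up]; have := chartK 0 p; have := chart_itv 0 p; rewrite add0r.
set x := chart 0 p => x01 xp.
have : nbhs (pi x) U by rewrite xp; exact: open_nbhs_nbhs.
move=> /nbhs_to_circle/nbhs_ballP[e /= e0 eU].
pose e' := Num.min e (1 - x).
have e'0 : 0 < e' by rewrite /e' lt_min e0; lra.
(* One unit d for rounding x up to a multiple of d, n + 1 for the support of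
   the bump, and one to spare. *)
have [k ke] : exists k, (n%:R + 3) / N ^+ k < e'.
  have C0 : 0 <= (N + 3) / e' by rewrite divr_ge0 ?ltW // addr_ge0.
  have kC := archi_boundP C0; set k := Num.Def.archi_bound _ in kC; exists k.
  have kN : k%:R < N ^+ k by rewrite -natrX ltr_nat ltn_expl.
  by rewrite ltr_pdivrMr ?(le_lt_trans _ kN) // mulrC -ltr_pdivrMr // (lt_trans kC).
have Nk : 0 < N ^+ k by rewrite exprn_gt0 // ltr0n; lia.
pose d := 1 / N ^+ k; pose m := Num.floor (x * N ^+ k).
pose s := (m + 1)%:~R / N ^+ k.
have d0 : 0 < d by rewrite /d divr_gt0.
have := floor_itv (x * N ^+ k); rewrite -/m => /andP[mx xm].
have xs : x < s by rewrite /s ltr_pdivlMr.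
have sx : s <= x + d.
  by rewrite /s /d intrD mulrDl lerD2r ler_pdivrMr.
have ed : (N + 3) * d < e' by rewrite /d mulrA mulr1.
have se : s + d + N * d < x + e' by lra.
have e'1 : e' <= e by rewrite /e' ge_min lexx.
have e'2 : e' <= 1 - x by rewrite /e' ge_min lexx orbT.
have s0 : 0 <= s by lra.
have sd1 : s + d + N * d <= 1 by lra.
have ns : nadic_real s by exists (m + 1), k.
have nd : nadic_real d by exists 1, k.
exists (thompson_bump s0 d0 sd1); split.
- exact: thompson_bumpP.
- exact: thompson_bump_neq1.
- move=> q nUq; apply: thompson_bump_id => qs; apply: nUq.
  rewrite -(chartK 0 q); apply: eU; rewrite /ball /= ltr_norml; lra.
Qed.

End ThompsonElements.

(** * Zariski continuity of evaluation on the circle *)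

Section Arc.
Variable R : realType.
Local Notation pi := (@to_circle R).

(** In the chart at v, g is a continuous injective real function, hence monotone
    from a to b, hence between its values at the endpoints. *)
Lemma arc_image (g : R -> circle R) (a b v l m x : R) : continuous g ->
  {in `[a, b] &, injective g} -> (forall t, t \in `[a, b] -> g t <> pi v) ->
  v <= l -> m <= v + 1 ->
  (pi @` `]l, m[%classic) (g a) -> (pi @` `]l, m[%classic) (g b) ->
  x \in `[a, b] -> (pi @` `]l, m[%classic) (g x).
Proof.
move=> cg ig gv vl mv [y + yga] [z + zgb] xab.
rewrite /= !in_itv /= => ylm zlm.
pose phi t := chart v (g t).
have phia : phi a = y by rewrite /phi -yga chart_id; lra.
have phib : phi b = z by rewrite /phi -zgb chart_id; lra.
have cphi : {within `[a, b], continuous phi}.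
  apply: continuous_subspace_itv => t tab.
  apply: (@continuous_comp _ _ _ g (chart v)); first exact: cg.
  by apply: chart_continuous; exact: gv.
have iphi : {in `[a, b] &, injective phi}.
  by move=> s t sab tab /(can_inj (chartK v)); exact: ig.
have ab : a <= b by move: xab; rewrite in_itv /=; lra.
have aab : a \in `[a, b] by rewrite bound_itvE.
have bab : b \in `[a, b] by rewrite bound_itvE.
have [ax xb] : a <= x /\ x <= b by move: xab; rewrite in_itv /=; lra.
exists (phi x); last exact: chartK.
rewrite /= in_itv /=.
have [pab|pab] := leP (phi a) (phi b).
  have mono := segment_continuous_inj_le pab cphi iphi.
  have : phi a <= phi x by rewrite mono.
  have : phi x <= phi b by rewrite mono.
  by rewrite phia phib; lra.
have mono := segment_continuous_inj_ge (ltW pab) cphi iphi.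
have : phi x <= phi a by rewrite mono.
have : phi b <= phi x by rewrite mono.
by rewrite phia phib; lra.
Qed.

(** The point c lies on the complementary arc from b back to a, so by injectivity
    f does not take the value f(c) between a and b; cut the circle there. *)
Lemma homeo_arc (f : homeo (circle R)) (a b c l m x : R) : b < c < a + 1 ->
  (pi @` `]l, m[%classic) (f (pi a)) -> (pi @` `]l, m[%classic) (f (pi b)) ->
  (pi @` `]m, l + 1[%classic) (f (pi c)) ->
  x \in `[a, b] -> (pi @` `]l, m[%classic) (f (pi x)).
Proof.
move=> bc Ja Jb [v + vE]; rewrite /= in_itv /= => vlm.
have cf : continuous (f \o pi).
  move=> t; apply: continuous_comp; first exact: to_circle_continuous.
  exact: homeo_continuous.
apply: (@arc_image (f \o pi) a b (v - 1)) => //; [| |lra|lra].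
  move=> s t; rewrite !in_itv /= => sab tab /homeo_injective.
  by apply: to_circle_inj; rewrite ltr_norml; lra.
move=> t; rewrite in_itv /= => tab.
rewrite -[-1]/((-1)%:~R) to_circleDz vE => /homeo_injective tc.
suff : t = c by lra.
by apply: to_circle_inj tc; rewrite ltr_norml; lra.
Qed.

Variable G : groupClosed (homeo (circle R)).
Hypothesis rG : micro_supported [set` G].

Lemma open_arc (a b : R) : open (pi @` `]a, b[%classic).
Proof. by apply: to_circle_open; exact: interval_open. Qed.

(** Take J a short arc around f0(p0) and W the complementary arc. The three
    conditions are that f sends into J some point just before p0 and some point
    just after p0, and into W some point near r0, where f0(r0) is in
    W. They are Zariski-open and imply that f sends a fixed neighbourhood of
    p0 into J. *)
Lemma zariski_eval_near (f0 : zariski (subgroup G)) (p0 : circle R)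
    (U : set (circle R)) :
  nbhs (act f0 p0) U -> \forall f \near f0 & p \near p0, U (act f p).
Proof.
have [x0 ->] := to_circle_surj p0.
have [y0 y0E] := to_circle_surj (act f0 (pi x0)).
rewrite y0E => /nbhs_to_circle/nbhs_ballP[e /= e0 eU].
(* With eta < 1/2 the point y0 + 1/2, opposite to y0, lies in W. *)
pose eta := Num.min e (1 / 4).
have eta0 : 0 < eta by rewrite lt_min e0; lra.
have etae : eta <= e by rewrite ge_min lexx.
have eta4 : eta <= 1 / 4 by rewrite ge_min lexx orbT.
pose J := pi @` `]y0 - eta, y0 + eta[%classic.
have JU : J `<=` U.
  move=> _ [y + <-]; rewrite /= in_itv /= => yy; apply: eU.
  by rewrite /ball /= ltr_norml; lra.
have oJ : open J by exact: open_arc.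
pose W := pi @` `]y0 + eta, y0 + 1 - eta[%classic.
have oW : open W by exact: open_arc.
have JW t : J t -> W t -> False.
  move=> [y + <-] [z + /to_circleP/intrP[k kE]]; rewrite /= !in_itv /= => yy zz.
  have : 0%:~R < k%:~R :> R by rewrite -kE; lra.
  have : k%:~R < 1%:~R :> R by rewrite -kE; lra.
  by rewrite !ltr_int; lia.
have cf0 : continuous (act f0 \o pi).
  move=> x; apply: continuous_comp; first exact: to_circle_continuous.
  exact: homeo_continuous.
have : nbhs x0 ((act f0 \o pi) @^-1` J).
  apply: cf0; apply: open_nbhs_nbhs; split=> //; exists y0 => //.
  by rewrite /= in_itv /=; lra.
move=> /nbhs_ballP[d /= d0 dJ].
have [r0 r0E] : exists r0, W (act f0 r0).
  (* The preimage of the point opposite to f0(p0). *)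
  exists (homeo_inv (val (f0 : subgroup G)) (pi (y0 + 1 / 2))).
  rewrite /act homeoVK; exists (y0 + 1 / 2) => //; rewrite /= in_itv /=; lra.
have := chartK x0 r0; have := chart_itv x0 r0; set c0 := chart x0 r0 => c0x c0r.
have nJ t : `|x0 - t| < d -> pi t <> r0.
  by move=> td tr; apply: (@JW (act f0 r0)) => //; rewrite -tr; exact: dJ.
have c0d : x0 + d <= c0.
  rewrite leNgt; apply/negP => c0d; apply: (nJ c0) => //; rewrite ltr_norml; lra.
have c0d' : c0 <= x0 + 1 - d.
  rewrite leNgt; apply/negP => c0d'; apply: (nJ (c0 - 1)).
    by rewrite ltr_norml; lra.
  by rewrite -c0r -[-1]/((-1)%:~R) to_circleDz.
(* Halving d keeps the interval around c0 away from the one around x0, on both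
   sides of the circle. *)
pose d' := d / 2.
have hitJ (l m : R) t : l < t < m -> x0 - d < t < x0 + d ->
    \forall f \near f0, exists2 q, (pi @` `]l, m[%classic) q & J (act f q).
  move=> ltm td; apply: (zariski_hit (@circle_hausdorff R) rG (p := pi t)).
  - exact: open_arc.
  - exact: oJ.
  - by exists t => //; rewrite /= in_itv.
  - by apply: dJ; rewrite /ball /= ltr_norml; lra.
have hit1 := hitJ (x0 - d') (x0 - d' / 2) (x0 - d' * 3 / 4).
have hit2 := hitJ (x0 + d' / 2) (x0 + d') (x0 + d' * 3 / 4).
have hit3 : \forall f \near f0,
    exists2 q, (pi @` `]c0 - d', c0 + d'[%classic) q & W (act f q).
  apply: (zariski_hit (@circle_hausdorff R) rG (p := r0)).
  - exact: open_arc.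
  - exact: oW.
  - by exists c0; [rewrite /= in_itv /= /d'; lra|exact: c0r].
  - exact: r0E.
have dE : d' = d / 2 by [].
near=> f p; apply: JU.
have : exists x, p = pi x /\ x0 - d' / 2 < x < x0 + d' / 2.
  near: p; apply/nbhs_to_circle; near=> x.
  exists x; split=> //; apply/andP; split.
    by near: x; apply: lt_nbhsr; rewrite /d'; lra.
  by near: x; apply: lt_nbhsl; rewrite /d'; lra.
move=> [x [-> xd]].
have [_ [a + <-] Ja] :
    exists2 q, (pi @` `]x0 - d', (x0 - d' / 2)[%classic) q & J (act f q).
  by near: f; apply: hit1; rewrite /d'; lra.
have [_ [b + <-] Jb] :
    exists2 q, (pi @` `]x0 + d' / 2, (x0 + d')[%classic) q & J (act f q).
  by near: f; apply: hit2; rewrite /d'; lra.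
have [_ [c + <-] Wc] :
    exists2 q, (pi @` `]c0 - d', c0 + d'[%classic) q & W (act f q).
  by near: f; exact: hit3.
rewrite /= !in_itv /= => cc bb aa.
apply: (@homeo_arc (val (f : subgroup G)) a b c) => //.
- by clear -cc bb aa c0d c0d' dE; lra.
- by rewrite (_ : y0 - eta + 1 = y0 + 1 - eta) //; ring.
- by rewrite in_itv /=; clear -xd bb aa; lra.
Unshelve. all: by end_near. Qed.

End Arc.

(** * Comparison of the two topologies *)

Section SubgroupTopology.
Variables (X : topologicalType) (G : groupClosed (homeo X)).
Hypotheses (cX : compact [set: X]) (hX : hausdorff_space X).
Local Notation CO := (compact_open_subgroup G).
Local Notation Zar := (zariski (subgroup G)).

Lemma val_continuous : continuous (val : CO -> homeo X).
Proof. exact: initial_continuous. Qed.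

Lemma continuous_to_subgroup (T : topologicalType) (f : T -> CO) :
  continuous (fun t => val (f t) : homeo X) -> continuous f.
Proof. exact: continuous_comp_initial. Qed.

Lemma subgroup_mul_continuous :
  continuous (fun p : CO * CO => ((p.1 : subgroup G) * p.2)%g : CO).
Proof.
apply: continuous_to_subgroup => p.
apply: (@continuous_comp _ _ _
  (fun p : CO * CO => (val p.1 : homeo X, val p.2 : homeo X))
  (fun q => homeo_mul q.1 q.2)); last exact: homeo_mul_continuous.
have c1 := @continuous_comp _ _ _ fst (val : CO -> homeo X) p
  (@cvg_fst _ _ _ _ _) (@val_continuous _).
have c2 := @continuous_comp _ _ _ snd (val : CO -> homeo X) p
  (@cvg_snd _ _ _ _ _) (@val_continuous _).
exact: (cvg_pair (c1 _) (c2 _)).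
Qed.

Lemma subgroup_inv_continuous :
  continuous (fun f : CO => ((f : subgroup G)^-1)%g : CO).
Proof.
apply: continuous_to_subgroup => f.
apply: (@continuous_comp _ _ _ (val : CO -> homeo X) (@homeo_inv X)).
  exact: val_continuous.
exact: homeo_inv_continuous.
Qed.

Lemma subgroup_hausdorff : hausdorff_space CO.
Proof.
move=> f g fg; apply: val_inj; apply: (homeo_hausdorff cX hX) => A B Af Bg.
have [h [Ah Bh]] := fg _ _ (val_continuous Af) (val_continuous Bg).
by exists (val h).
Qed.

Lemma subgroup_mul_cts (T : topologicalType) (u v : T -> CO) :
  continuous u -> continuous v ->
  continuous (fun t => ((u t : subgroup G) * v t)%g : CO).
Proof.
move=> cu cv t; apply: (@continuous_comp _ _ _ (fun t => (u t, v t))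
  (fun p : CO * CO => ((p.1 : subgroup G) * p.2)%g : CO)).
  exact: cvg_pair (cu t) (cv t).
exact: subgroup_mul_continuous.
Qed.

Lemma subgroup_expgz_continuous (k : int) :
  continuous (fun f : CO => expgz (f : subgroup G) k : CO).
Proof.
have expn_cts n : continuous (fun f : CO => ((f : subgroup G) ^+ n)%g : CO).
  elim: n => [|n IHn].
    rewrite (_ : (fun f : CO => _) = (fun=> (1%g : subgroup G) : CO)).
      exact: cst_continuous.
    by apply: funext => f; rewrite expg0.
  rewrite (_ : (fun f : CO => _) =
    (fun f : CO => ((f : subgroup G) * (f : subgroup G) ^+ n)%g : CO)).
    by apply: subgroup_mul_cts => // f; exact: cvg_id.
  by apply: funext => f; rewrite expgS.
case: k => n; first exact: expn_cts.
move=> f; apply: (@continuous_comp _ _ _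
   (fun f : CO => ((f : subgroup G) ^+ n.+1)%g : CO)
   (fun f : CO => ((f : subgroup G)^-1)%g : CO)).
  exact: expn_cts.
exact: subgroup_inv_continuous.
Qed.

Lemma word_continuous (l : nat) (g : nat -> subgroup G) (k : nat -> int) :
  continuous (fun f : CO =>
    (g 0%N * \prod_(i < l) (expgz (f : subgroup G) (k i) * g i.+1))%g : CO).
Proof.
elim: l => [|l IHl].
  rewrite (_ : (fun f : CO => _) = (fun=> g 0%N : CO)).
    exact: cst_continuous.
  by apply: funext => f; rewrite big_ord0 mulg1.
rewrite (_ : (fun f : CO => _) = (fun f : CO =>
  (g 0%N * \prod_(i < l) (expgz (f : subgroup G) (k i) * g i.+1) *
   (expgz (f : subgroup G) (k l) * g l.+1))%g : CO)).
  apply: subgroup_mul_cts => //; apply: subgroup_mul_cts.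
    exact: subgroup_expgz_continuous.
  exact: cst_continuous.
by apply: funext => f; rewrite big_ord_recr /= mulgA.
Qed.

(** In a Hausdorff topological group, the complement of 1 is open and so is its
    preimage under a word map. *)
Lemma compact_open_to_zariski : continuous (id : CO -> Zar).
Proof.
apply: continuous_to_zariski => _ [l [g [k ->]]].
have o1 : open (~` [set (1%g : subgroup G) : CO]).
  apply/closed_openC/accessible_closed_set1/hausdorff_accessible.
  exact: subgroup_hausdorff.
have := @open_comp _ _ _ _ (in1W (@word_continuous l g k)) o1.
by congr (open _); apply: eq_set => f; apply/propext; split=> /nesym.
Qed.

Lemma zariski_to_compact_open :
  (forall (f0 : Zar) (p0 : X) (U : set X), nbhs (act f0 p0) U ->
    \forall f \near f0 & p \near p0, U (act f p)) ->
  continuous (id : Zar -> CO).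
Proof.
move=> ev; apply: continuous_to_subgroup; apply: continuous_to_homeo.
by move=> z U; exact: ev.
Qed.

End SubgroupTopology.

Theorem theorem2p2 (R : realType) (n : nat)
    (G : groupClosed (homeo (circle R))) :
  (2 <= n)%N ->
  thompsonT R n `<=` [set` G] ->
  [/\ (@open (zariski (subgroup G)) : set (set (subgroup G))) =
        @open (compact_open_subgroup G),
      hausdorff_space (zariski (subgroup G)) &
      group_topology (zariski (subgroup G))].
Proof.
move=> n2 TG; have cX := @circle_compact R; have hX := @circle_hausdorff R.
have rG : micro_supported [set` G].
  move=> U oU U0; have [b [Tb b1 bU]] := thompson_micro_supported n2 oU U0.
  by exists b; split=> //; exact: TG.
have cz := compact_open_to_zariski (G := G) cX hX.
have zc := zariski_to_compact_open (zariski_eval_near rG).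
split.
- apply/seteqP; split=> U oU.
    by move/continuousP : cz => /(_ _ oU).
  by move/continuousP : zc => /(_ _ oU).
- move=> f g fg; apply: (subgroup_hausdorff cX hX) => A B Af Bg.
  exact: fg (zc _ _ Af) (zc _ _ Bg).
- pose Z := zariski (subgroup G); pose C := compact_open_subgroup G.
  have cpair : continuous (fun p : Z * Z => (p.1 : C, p.2 : C)).
    move=> p.
    have c1 := @continuous_comp _ _ _ (fst : Z * Z -> Z) (id : Z -> C) p
      cvg_fst (zc _).
    have c2 := @continuous_comp _ _ _ (snd : Z * Z -> Z) (id : Z -> C) p
      cvg_snd (zc _).
    exact: (cvg_pair (c1 _) (c2 _)).
  have cmul : continuous (fun q : C * C => ((q.1 : subgroup G) * q.2)%g : Z).
    move=> q; exact: (@continuous_comp _ _ _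
      (fun q : C * C => ((q.1 : subgroup G) * q.2)%g : C) (id : C -> Z) q
      (subgroup_mul_continuous cX hX (x := q)) (cz _)).
  have cinv : continuous (fun q : C => ((q : subgroup G)^-1)%g : Z).
    move=> q; exact: (@continuous_comp _ _ _
      (fun q : C => ((q : subgroup G)^-1)%g : C) (id : C -> Z) q
      (subgroup_inv_continuous cX hX (x := q)) (cz _)).
  split=> p.
    exact: (@continuous_comp _ _ _ (fun p : Z * Z => (p.1 : C, p.2 : C))
      (fun q : C * C => ((q.1 : subgroup G) * q.2)%g : Z) p (cpair p) (cmul _)).
  exact: (@continuous_comp _ _ _ (id : Z -> C)
    (fun q : C => ((q : subgroup G)^-1)%g : Z) p (zc p) (cinv _)).
Qed.
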